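(* Let $C$ be a differentiable cycle on $\Sigma$ not meeting $\{P_+,P_-\}\cup W$. (a) The cocycle $\gamma_{2,\omega,C}$ does not depend on the choice of the connection form $\omega$. (b) The cohomology class $[\gamma_{1,\omega,C}]\in\mathrm H^2(\overline{\mathfrak g},\mathbb C)$ does not depend on the choice of the connection form $\omega$. More precisely, for any two connection forms $\omega,\omega'$ and all $L,L'\in\overline{\mathfrak g}$, $$\gamma_{1,\omega,C}(L,L')-\gamma_{1,\omega',C}(L,L')=-\frac1{2\pi i}\int_C\operatorname{tr}\big((\omega-\omega')[L,L']\big).$$
   Context: Setting. $\Sigma$ is a compact Riemann surface of genus $g$ with two distinct marked points $P_+,P_-$; $n\in\mathbb N$; $W=\{\gamma_1,\dots,\gamma_{ng}\}\subset\Sigma\setminus\{P_+,P_-\}$ is a set of $ng$ further points, all marked points being in generic position; $z_s$ is a fixed local coordinate centred at $\gamma_s$. $\mathfrak g$ is one of the complex matrix Lie algebras $\mathfrak{gl}(n)$, $\mathfrak{sl}(n)$, $\mathfrak{so}(n)$ (skew-symmetric matrices), $\mathfrak{sp}(2n)=\{X: X^t\sigma+\sigma X=0\}$ ($\sigma$ a nondegenerate skew-symmetric $2n\times 2n$ matrix), $\mathfrak s(n)$ (scalar $n\times n$ matrices). To each $\gamma_s$ a vector $\alpha_s\in\mathbb C^n$ is attached ($\alpha_s\in\mathbb C^{2n}$ for $\mathfrak{sp}(2n)$; $\alpha_s^t\alpha_s=0$ for $\mathfrak{so}(n)$). Lax operator algebra. $\overline{\mathfrak g}$ is the Lie algebra,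 under the pointwise commutator, of all meromorphic $L:\Sigma\to\mathfrak g$, holomorphic outside $W\cup\{P_+,P_-\}$, whose Laurent expansion $L=\sum_k L_{s,k}z_s^k$ at each $\gamma_s$ satisfies: for $\mathfrak{gl}(n),\mathfrak{sl}(n)$: $L_{s,k}=0$ for $k<-1$ and there are $\beta_s\in\mathbb C^n,\kappa_s\in\mathbb C$ with $L_{s,-1}=\alpha_s\beta_s^t$, $\beta_s^t\alpha_s=0$, $L_{s,0}\alpha_s=\kappa_s\alpha_s$; for $\mathfrak{so}(n)$: the same with $L_{s,-1}=\alpha_s\beta_s^t-\beta_s\alpha_s^t$; for $\mathfrak{sp}(2n)$: $L_{s,k}=0$ for $k<-2$ and there are $\beta_s\in\mathbb C^{2n},\nu_s,\kappa_s\in\mathbb C$ with $L_{s,-2}=\nu_s\alpha_s\alpha_s^t\sigma$, $L_{s,-1}=(\alpha_s\beta_s^t+\beta_s\alpha_s^t)\sigma$, $\beta_s^t\sigma\alpha_s=0$, $L_{s,0}\alpha_s=\kappa_s\alpha_s$, $\alpha_s^t\sigma L_{s,1}\alpha_s=0$; for $\mathfrak s(n)$: $L$ is holomorphic at $W$. Connection forms. A connection form $\omega$ is a meromorphic matrix-valued 1-form on $\Sigma$, with values in $\mathfrak g$ for $\mathfrak{so}(n),\mathfrak{sp}(2n)$ and in $\mathfrak{gl}(n)$ for $\mathfrak{gl}(n),\mathfrak{sl}(n),\mathfrak s(n)$, holomorphic outside $W\cup\{P_-\}$ (in particular holomorphic at $P_+$), holomorphic at $\gamma_s$ if $\alpha_s=0$,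 and if $\alpha_s\ne0$ with expansion $\omega=(\omega_{s,-1}z_s^{-1}+\omega_{s,0}+\omega_{s,1}z_s+\cdots)dz_s$ such that for some vector $\tilde\beta_s$ and $\tilde\kappa_s\in\mathbb C$: $\omega_{s,0}\alpha_s=\tilde\kappa_s\alpha_s$ and ($\mathfrak{gl},\mathfrak{sl},\mathfrak s$) $\omega_{s,-1}=\alpha_s\tilde\beta_s^t$, $\tilde\beta_s^t\alpha_s=1$; ($\mathfrak{so}$) $\omega_{s,-1}=\alpha_s\tilde\beta_s^t-\tilde\beta_s\alpha_s^t$, $\tilde\beta_s^t\alpha_s=1$; ($\mathfrak{sp}$) $\omega_{s,-1}=(\alpha_s\tilde\beta_s^t+\tilde\beta_s\alpha_s^t)\sigma$, $\tilde\beta_s^t\sigma\alpha_s=1$, $\alpha_s^t\sigma\omega_{s,1}\alpha_s=0$. Put $\nabla^{(\omega)}L=dL+[\omega,L]$. Cocycles. A (2-)cocycle is an antisymmetric bilinear form $\gamma:\overline{\mathfrak g}\times\overline{\mathfrak g}\to\mathbb C$ with $\gamma([L,L'],L'')+\gamma([L',L''],L)+\gamma([L'',L],L')=0$; coboundaries are those of the form $(L,L')\mapsto\phi([L,L'])$ with $\phi$ linear; $\mathrm H^2(\overline{\mathfrak g},\mathbb C)$ is cocycles modulo coboundaries. The geometric cocycles are $$\gamma_{1,\omega,C}(L,L')=\frac1{2\pi i}\int_C\operatorname{tr}(L\cdot\nabla^{(\omega)}L'),\qquad \gamma_{2,\omega,C}(L,L')=\frac1{2\pi i}\int_C\operatorname{tr}(L)\operatorname{tr}(\nabla^{(\omega)}L').$$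 *)

(* Defs.v *)
From HB Require Import structures.
From mathcomp Require Import all_boot all_order all_algebra.
From mathcomp Require Import complex.
From mathcomp Require Import all_classical all_reals all_analysis.

Set Implicit Arguments.
Unset Strict Implicit.
Unset Printing Implicit Defensive.

Import Order.TTheory GRing.Theory Num.Theory.
Import numFieldNormedType.Exports.

Local Open Scope classical_set_scope.
Local Open Scope ring_scope.

(* [R[i]] packed as a [numFieldType], which is what triggers the canonical
   topology and the derivatives of MathComp-Analysis. *)
Definition Cplx (R : realType) : numFieldType := complex R.

Section Holomorphy.
Variable R : realType.
Notation C := (Cplx R).

(* Complex differentiable near [z] with continuous derivative; the continuity
   is part of the definition, as in Conway's textbook (by Goursat's theorem it
   is automatic). *)
Definition holo_at (f : C -> C) (z : C) : Prop :=
  \forall w \near z, derivable f w 1 /\ {for w, continuous (derive1 f)}.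

(* [F z = \sum_k a k z^k] on a punctured neighbourhood of 0, with finitely many
   negative powers. *)
Definition laurent d (F : C -> 'M[C]_d) (a : int -> 'M[C]_d) : Prop :=
  exists m : nat, (forall k : int, k < - m%:Z -> a k = 0) /\
  \forall z \near 0^', forall i j,
    (fun N : nat => \sum_(q < N) a (q%:Z - m%:Z) i j * z ^ (q%:Z - m%:Z))
      @ \oo --> F z i j.

End Holomorphy.

Section RiemannSurfaces.
Variable R : realType.
Notation C := (Cplx R).

(* [coord] and [param] are total; they are mutually inverse homeomorphisms
   between [dom] and its image, and carry junk values elsewhere. *)
Record chart (S : topologicalType) := Chart {
  dom : set S;
  coord : S -> C;
  param : C -> S;
  dom_open : open dom;
  img_open : open (coord @` dom);
  coord_continuous : forall p, dom p -> {for p, continuous coord};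
  param_continuous : forall z, (coord @` dom) z -> {for z, continuous param};
  coordK : forall p, dom p -> param (coord p) = p }.

Definition transition (S : topologicalType) (c d : chart S) : C -> C :=
  coord d \o param c.

Definition compatible (S : topologicalType) (c d : chart S) : Prop :=
  forall p, dom c p -> dom d p ->
    holo_at (transition c d) (coord c p) /\
    holo_at (transition d c) (coord d p).

(* Compact Riemann surface; the atlas is maximal, so that the members of
   [atlas] are exactly the holomorphic local coordinates. *)
Record riemann_surface := RiemannSurface {
  surface :> topologicalType;
  atlas : set (chart surface);
  surface_hausdorff : hausdorff_space surface;
  surface_compact : compact [set: surface];
  surface_connected : connected [set: surface];
  atlas_cover : forall p : surface, exists c, atlas c /\ dom c p;
  atlas_compatible : forall c d, atlas c -> atlas d -> compatible c d;
  atlas_maximal : forall c, (forall d, atlas d -> compatible c d) -> atlas c }.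

Variable S : riemann_surface.

Definition chart_at (p : S) : chart S := projT1 (cid (atlas_cover p)).

(* A 1-form [eta] is given by its coefficients: at [p] in [dom c] it equals
   [eta c p * dz_c].  At poles the coefficient is a junk value. *)
Definition form := chart S -> S -> C.
Definition mxform d := chart S -> S -> 'M[C]_d.

Definition is_form (eta : form) : Prop :=
  forall c d p, atlas c -> atlas d -> dom c p -> dom d p ->
    eta c p = eta d p * derive1 (transition c d) (coord c p).

Definition form_holo_at (eta : form) (p : S) : Prop :=
  forall c, atlas c -> dom c p -> holo_at (eta c \o param c) (coord c p).

Definition entry d (w : mxform d) (i j : 'I_d) : form := fun c p => w c p i j.

Definition fun_holo_at (f : S -> C) (p : S) : Prop :=
  forall c, atlas c -> dom c p -> holo_at (f \o param c) (coord c p).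

Definition mxfun_meromorphic_at d (L : S -> 'M[C]_d) (p : S) : Prop :=
  exists c, [/\ atlas c, dom c p, coord c p = 0 &
    exists a, laurent (L \o param c) a].

Definition mxform_meromorphic_at d (w : mxform d) (p : S) : Prop :=
  exists c, [/\ atlas c, dom c p, coord c p = 0 &
    exists a, laurent (w c \o param c) a].

(* [g] is the dimension of the space of holomorphic 1-forms. *)
Definition has_genus (g : nat) : Prop :=
  let holomorphic eta := is_form eta /\ forall p, form_holo_at eta p in
  exists eta : 'I_g -> form, (forall i, holomorphic (eta i)) /\
    forall theta, holomorphic theta -> exists! x : 'rV[C]_g,
      forall c p, atlas c -> dom c p ->
        theta c p = \sum_(i < g) x 0 i * eta i c p.

(* Formal integral combinations of paths; only the restriction of a path to
   [0, 1] is meaningful. *)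
Record chain := Chain {
  nb_paths : nat;
  mult : 'I_nb_paths -> int;
  simplex : 'I_nb_paths -> R -> S }.

Definition C1_at (f : R -> R) (t : R) : Prop :=
  \forall s \near t, derivable f s 1 /\ {for s, continuous (derive1 f)}.

(* At the end points this asks for a C^1 extension past [0, 1]. *)
Definition C1_path (gam : R -> S) : Prop :=
  forall t, 0 <= t <= 1 -> {for t, continuous gam} /\
    forall c, atlas c -> dom c (gam t) ->
      C1_at (fun s => complex.Re (coord c (gam s))) t /\
      C1_at (fun s => complex.Im (coord c (gam s))) t.

Definition differentiable_cycle (A : set S) (Z : chain) : Prop :=
  (forall i : 'I_(nb_paths Z), C1_path (simplex i) /\
     forall t, 0 <= t <= 1 -> A (simplex i t)) /\
  (forall p : S, \sum_(i < nb_paths Z)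
     mult i * ((simplex i 1 == p)%:R - (simplex i 0 == p)%:R) = 0).

Definition velocity (c : chart S) (gam : R -> S) (t : R) : C :=
  Complex (derive1 (fun s => complex.Re (coord c (gam s))) t)
          (derive1 (fun s => complex.Im (coord c (gam s))) t).

(* The value of the integrand does not depend on the chart around [gam t]. *)
Definition path_integral (gam : R -> S) (eta : form) : C :=
  let f t := let c := chart_at (gam t) in eta c (gam t) * velocity c gam t in
  Complex (\int[lebesgue_measure]_(t in `[0, 1]) complex.Re (f t))
          (\int[lebesgue_measure]_(t in `[0, 1]) complex.Im (f t)).

Definition chain_integral (Z : chain) (eta : form) : C :=
  \sum_(i < nb_paths Z) path_integral (simplex i) eta *~ mult i.

Definition two_pi_i : C := Complex 0 (2 * pi).

End RiemannSurfaces.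

Section LaxOperators.
Variable R : realType.
Notation C := (Cplx R).

Inductive lie_kind (n : nat) :=
| Lgl | Lsl | Lso
| Lsp (sigma : 'M[C]_(2 * n)) of sigma^T = - sigma & sigma \in unitmx
| Lscal.

Definition msize n (k : lie_kind n) : nat :=
  if k is Lsp _ _ _ then (2 * n)%N else n.

Definition in_lie n (k : lie_kind n) : 'M[C]_(msize k) -> Prop :=
  match k return 'M[C]_(msize k) -> Prop with
  | Lgl => fun _ => True
  | Lsl => fun X => \tr X = 0
  | Lso => fun X => X^T = - X
  | Lsp sigma _ _ => fun X => X^T *m sigma + sigma *m X = 0
  | Lscal => fun X => exists a, X = a%:M
  end.

Definition in_conn_lie n (k : lie_kind n) : 'M[C]_(msize k) -> Prop :=
  match k return 'M[C]_(msize k) -> Prop with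
  | Lso => @in_lie n (Lso n)
  | Lsp sigma h1 h2 => @in_lie n (Lsp h1 h2)
  | _ => fun _ => True
  end.

Definition tyurin_ok n (k : lie_kind n) : 'cV[C]_(msize k) -> Prop :=
  match k return 'cV[C]_(msize k) -> Prop with
  | Lso => fun al => al^T *m al = 0
  | _ => fun _ => True
  end.

(* [a] is the family of Laurent coefficients at a point with vector [al]. *)
Definition lax_coef n (k : lie_kind n) :
    'cV[C]_(msize k) -> (int -> 'M[C]_(msize k)) -> Prop :=
  match k return 'cV[C]_(msize k) -> (int -> 'M[C]_(msize k)) -> Prop with
  | Lgl | Lsl => fun al a => (forall q : int, q < -1 -> a q = 0) /\
      exists be : 'cV[C]_n, exists ka : C,
        [/\ a (-1) = al *m be^T, be^T *m al = 0 & a 0 *m al = ka *: al]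
  | Lso => fun al a => (forall q : int, q < -1 -> a q = 0) /\
      exists be : 'cV[C]_n, exists ka : C,
        [/\ a (-1) = al *m be^T - be *m al^T, be^T *m al = 0 &
            a 0 *m al = ka *: al]
  | Lsp sigma _ _ => fun al a => (forall q : int, q < -2 -> a q = 0) /\
      exists be : 'cV[C]_(2 * n), exists nu ka : C,
        [/\ a (-2) = nu *: (al *m al^T *m sigma),
            a (-1) = (al *m be^T + be *m al^T) *m sigma,
            be^T *m sigma *m al = 0,
            a 0 *m al = ka *: al &
            al^T *m sigma *m a 1 *m al = 0]
  | Lscal => fun _ a => forall q : int, q < 0 -> a q = 0
  end.

(* Only used when [al] is nonzero. *)
Definition conn_coef n (k : lie_kind n) :
    'cV[C]_(msize k) -> (int -> 'M[C]_(msize k)) -> Prop :=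
  match k return 'cV[C]_(msize k) -> (int -> 'M[C]_(msize k)) -> Prop with
  | Lgl | Lsl | Lscal => fun al a => (forall q : int, q < -1 -> a q = 0) /\
      exists be : 'cV[C]_n, exists ka : C,
        [/\ a (-1) = al *m be^T, be^T *m al = 1%:M & a 0 *m al = ka *: al]
  | Lso => fun al a => (forall q : int, q < -1 -> a q = 0) /\
      exists be : 'cV[C]_n, exists ka : C,
        [/\ a (-1) = al *m be^T - be *m al^T, be^T *m al = 1%:M &
            a 0 *m al = ka *: al]
  | Lsp sigma _ _ => fun al a => (forall q : int, q < -1 -> a q = 0) /\
      exists be : 'cV[C]_(2 * n), exists ka : C,
        [/\ a (-1) = (al *m be^T + be *m al^T) *m sigma,
            be^T *m sigma *m al = 1%:M,
            a 0 *m al = ka *: al &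
            al^T *m sigma *m a 1 *m al = 0]
  end.

Record lax_data (S : riemann_surface R) (g n : nat) := LaxData {
  Pplus : S;
  Pminus : S;
  gpt : 'I_(n * g) -> S;
  zloc : 'I_(n * g) -> chart R S;
  kind : lie_kind n;
  alpha : 'I_(n * g) -> 'cV[C]_(msize kind);
  Pplus_neq_Pminus : Pplus <> Pminus;
  gpt_inj : injective gpt;
  gpt_neq_Pplus : forall s, gpt s <> Pplus;
  gpt_neq_Pminus : forall s, gpt s <> Pminus;
  zloc_atlas : forall s, atlas (zloc s);
  zloc_dom : forall s, dom (zloc s) (gpt s);
  zloc_centred : forall s, coord (zloc s) (gpt s) = 0;
  alpha_ok : forall s, tyurin_ok (alpha s) }.

Section Data.
Variables (S : riemann_surface R) (g n : nat) (D : lax_data S g n).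
Notation M := 'M[C]_(msize (kind D)).

Definition marked : set S :=
  [set p | [\/ p = Pplus D, p = Pminus D | exists s, p = gpt D s]].

(* A meromorphic function that is holomorphic off the marked points is
   represented by the total function equal to it there and to 0 at the marked
   points; its possible regular values at marked points are not lost, being
   the limits read off the Laurent expansions. *)
Definition lax_algebra : set (S -> M) :=
  [set L | [/\ forall p, in_lie (L p),
    forall p, marked p -> L p = 0,
    forall p, ~ marked p -> forall i j, fun_holo_at (fun q => L q i j) p,
    mxfun_meromorphic_at L (Pplus D) /\ mxfun_meromorphic_at L (Pminus D) &
    forall s, exists a, laurent (L \o param (zloc D s)) a /\
      lax_coef (alpha D s) a]].

Definition mxform_holo_at (w : mxform S (msize (kind D))) (p : S) : Prop :=
  forall i j, form_holo_at (entry w i j) p.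

Definition connection_form (w : mxform S (msize (kind D))) : Prop :=
  [/\ forall i j, is_form (entry w i j),
    forall c p, atlas c -> dom c p -> in_conn_lie (w c p),
    forall p, p <> Pminus D -> (forall s, p <> gpt D s) -> mxform_holo_at w p,
    mxform_meromorphic_at w (Pminus D) &
    forall s, (alpha D s = 0 -> mxform_holo_at w (gpt D s)) /\
      (alpha D s <> 0 -> exists a,
         laurent (w (zloc D s) \o param (zloc D s)) a /\
         conn_coef (alpha D s) a)].

Definition mxbr (X Y : M) : M := X *m Y - Y *m X.

Definition bracket (L L' : S -> M) : S -> M := fun p => mxbr (L p) (L' p).

Definition dfun (L : S -> M) : mxform S (msize (kind D)) := fun c p =>
  \matrix_(i, j) derive1 (fun z => L (param c z) i j) (coord c p).

Definition nabla (w : mxform S (msize (kind D))) (L : S -> M) :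
    mxform S (msize (kind D)) :=
  fun c p => dfun L c p + mxbr (w c p) (L p).

Definition cochain := (S -> M) -> (S -> M) -> C.

Definition gamma1 (w : mxform S (msize (kind D))) (Z : chain S) : cochain :=
  fun L L' => (two_pi_i R)^-1 *
    chain_integral Z (fun c p => \tr (L p *m nabla w L' c p)).

Definition gamma2 (w : mxform S (msize (kind D))) (Z : chain S) : cochain :=
  fun L L' => (two_pi_i R)^-1 *
    chain_integral Z (fun c p => \tr (L p) * \tr (nabla w L' c p)).

(* Linearity, cocycles and coboundaries concern elements of [lax_algebra] only;
   the values of the total functions elsewhere are irrelevant. *)
Definition lin (x : C) (L L' : S -> M) : S -> M := fun p => x *: L p + L' p.

Definition linear_form (phi : (S -> M) -> C) : Prop :=
  forall x L L', lax_algebra L -> lax_algebra L' ->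
    phi (lin x L L') = x * phi L + phi L'.

Definition cocycle (ga : cochain) : Prop :=
  [/\ forall L, lax_algebra L -> linear_form (ga L),
    forall L', lax_algebra L' -> linear_form (ga^~ L'),
    forall L L', lax_algebra L -> lax_algebra L' -> ga L L' = - ga L' L &
    forall L L' L'', lax_algebra L -> lax_algebra L' -> lax_algebra L'' ->
      ga (bracket L L') L'' + ga (bracket L' L'') L +
      ga (bracket L'' L) L' = 0].

Definition coboundary (ga : cochain) : Prop :=
  exists phi, linear_form phi /\
    forall L L', lax_algebra L -> lax_algebra L' ->
      ga L L' = phi (bracket L L').

(* The element of H^2 represented by the cocycle [ga]. *)
Definition H2_class (ga : cochain) : set cochain :=
  [set ga' | cocycle ga' /\
     coboundary (fun L L' => ga' L L' - ga L L')].

End Data.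
End LaxOperators.

Arguments lax_algebra {R S g n} D.
Arguments connection_form {R S g n} D w.
Arguments gamma1 {R S g n} D w Z.
Arguments gamma2 {R S g n} D w Z.
Arguments cocycle {R S g n} D ga.
Arguments H2_class {R S g n} D ga.

(* Main.v *)
From HB Require Import structures.
From mathcomp Require Import all_boot all_order all_algebra.
From mathcomp Require Import complex.
From mathcomp Require Import all_classical all_reals all_analysis.
From mathcomp Require Import ring.
Require Import Defs.

(** The cycle avoids the marked points, and away from them the Lax operators and
    the connection forms are all holomorphic.  The statement then follows from
    the fact that an exact form integrates to zero along a cycle, and from
    identities between traces of matrix products.

    The trace form is invariant, [tr (A [w, B]) = tr (w [B, A])]
    ([mxtrace_mul_commx]), which moves the connection form out of every
    commutator.  Hence:
    - the [w]-terms of [tr (L nabla L') + tr (L' nabla L)] are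
      [tr (w [L', L]) + tr (w [L, L']) = 0], and the remaining terms are
      [d tr (L L')], so that [gamma1] is antisymmetric;
    - in the cyclic sum of [tr ([L, L'] nabla L'')] the [w]-terms vanish by the
      Jacobi identity, and the remaining terms are [d tr ([L, L'] L'')], so that
      [gamma1] is a cocycle;
    - [tr (L [w - w', L']) = - tr ((w - w') [L, L'])], which is the formula for
      the difference of two [gamma1]; its right-hand side is a linear form
      evaluated at [[L, L']], so the difference is a coboundary.
    For [gamma2] the trace kills the commutator in [nabla L']: the integrand is
    [tr L * d (tr L')], in which the connection form does not appear, and
    integration by parts gives antisymmetry.

    The analytic part makes these pointwise identities integrable.  A path is
    known only through the real and imaginary parts of its local coordinates,
    and the integrand of a path integral is computed in a chart chosen
    independently for each time.  The chain rule for a holomorphic function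
    along a real curve ([is_derive_holo_curve]) shows that this choice is
    harmless ([integrandE]); then the integrand is continuous, path integrals
    are linear ([path_integral_linear]), and the integral of a differential is
    the difference of the end values ([path_integral_differential]).  Summing
    over a chain with zero boundary gives [chain_integral_differential]. *)
Set Implicit Arguments.
Unset Strict Implicit.
Unset Printing Implicit Defensive.

Import Order.TTheory GRing.Theory Num.Theory.
Import numFieldNormedType.Exports.

Local Open Scope classical_set_scope.
Local Open Scope ring_scope.

Local Open Scope complex_scope.

(** * Differentiation of functions and matrices over a numeric field *)

Lemma derivable1E (K : numFieldType) (V : normedModType K) (f : K -> V)
    (x : K) :
  derivable f x 1 =
  cvg ((fun h : K => h^-1 *: (f (h + x) - f x)) @ 0^').
Proof.
rewrite /derivable /=.
by under eq_fun do rewrite [_%:A]mulr1.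
Qed.

Lemma derivable1_continuous (K : numFieldType) (V : normedModType K)
    (f : K -> V) (x : K) : derivable f x 1 -> {for x, continuous f}.
Proof. by move=> /derivable1_diffP; exact: differentiable_continuous. Qed.

Lemma cvg_dnbhs0_shift (K : numFieldType) (T : topologicalType) (f : K -> T)
    (x : K) :
  {for x, continuous f} -> (fun h => f (h + x)) @ 0^' --> f x.
Proof.
move=> fc; have H : (f \o shift x) @ (0 : K) --> f x.
  by rewrite cvg_comp_shift add0r.
exact: cvg_within_filter H.
Qed.

Lemma is_derive1_cvg (K : numFieldType) (V : normedModType K) (f : K -> V)
    (x : K) (l : V) :
  (fun h : K => h^-1 *: (f (h + x) - f x)) @ 0^' --> l -> is_derive x 1 f l.
Proof.
move=> H; split; first by rewrite derivable1E; apply/cvg_ex; exists l.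
by rewrite -derive1E; exact: cvg_lim.
Qed.

(** Differentiability as a factorization: chain rules then need no division by
    an increment of the inner function, which may vanish. *)
Lemma caratheodory (K : numFieldType) (f : K -> K) (x : K) :
  derivable f x 1 -> exists g : K -> K,
    [/\ {for x, continuous g}, g x = derive1 f x &
        forall y, f y - f x = g y * (y - x)].
Proof.
move=> df.
exists (fun y => if y == x then derive1 f x else (f y - f x) / (y - x)).
split=> [||y]; last first.
- case: eqVneq => [->|yx]; first by rewrite !subrr mulr0.
  by rewrite divfK // subr_eq0.
- by rewrite eqxx.
rewrite /prop_for /continuous_at eqxx -[x in X in X --> _]add0r.
(* The limit is rewritten as the value at 0 of the translated function, so
   that the value at the point can be removed from the filter. *)
rewrite -cvg_comp_shift -[derive1 f x]/(if true then derive1 f x else 0).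
set g := (X in X @ _).
have -> : (if true then derive1 f x else 0) = g 0.
  by rewrite /g /= add0r eqxx.
apply/(@continuous_withinNx _ _ g 0); rewrite /g /= add0r eqxx.
move: df; rewrite derivable1E => df.
apply: cvg_trans df; apply: near_eq_cvg.
near=> h => /=.
have h0 : h != 0 by near: h; exact: nbhs_dnbhs_neq.
have hK : h + x - x = h by rewrite addrK.
rewrite ifF; first by rewrite hK; exact: mulrC.
by apply/negP => /eqP hx; move: h0; rewrite -hK hx subrr eqxx.
Unshelve. all: by end_near. Qed.

Lemma near_eq_continuous (T U : topologicalType) (f g : T -> U) (x : T) :
  (\forall y \near x, f y = g y) ->
  {for x, continuous f} -> {for x, continuous g}.
Proof.
move=> fg; rewrite /prop_for /continuous_at -(nbhs_singleton fg).
by apply: cvg_trans; apply: near_eq_cvg; apply: filterS fg => y ->.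
Qed.

Lemma is_derive1_comp_field (K : numFieldType) (f g : K -> K) (x : K) :
  derivable f x 1 -> derivable g (f x) 1 ->
  is_derive x 1 (g \o f) (derive1 g (f x) * derive1 f x).
Proof.
move=> df dg; have [k [kc kE gE]] := caratheodory dg.
apply: is_derive1_cvg.
have kfc := cvg_dnbhs0_shift (continuous_comp (derivable1_continuous df) kc).
rewrite -kE; move: df; rewrite derivable1E => df.
apply: cvg_trans (cvgM kfc df); apply: near_eq_cvg; apply: nearW => h.
by rewrite /= gE mulrCA.
Qed.

Lemma derivable_is_derive1 (K : numFieldType) (f : K -> K) (z : K) :
  derivable f z 1 -> is_derive z (1 : K) f (derive1 f z).
Proof. by move=> df; rewrite derive1E; split. Qed.

Section MatrixDerivatives.
Variable K : numFieldType.

Definition mxderive1 n (X : K -> 'M[K]_n) (z : K) : 'M[K]_n :=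
  \matrix_(i, j) derive1 (fun u => X u i j) z.

Lemma mxderive1E n (X : K -> 'M[K]_n) (z : K) i j :
  mxderive1 X z i j = derive1 (fun u => X u i j) z.
Proof. by rewrite /mxderive1 mxE. Qed.

Lemma is_derive_fun_sum (I : finType) (f : I -> K -> K) (df : I -> K) (z : K) :
  (forall i, is_derive z (1 : K) (f i) (df i)) ->
  is_derive z (1 : K) (fun w => \sum_i f i w) (\sum_i df i).
Proof.
move=> hf; elim: (index_enum I) => [|i s IH].
  by under eq_fun do rewrite big_nil; rewrite big_nil;
    exact: (is_derive_cst (0 : K)).
by under eq_fun do rewrite big_cons; rewrite big_cons;
  exact: (@is_deriveD _ _ _ _ _ _ _ _ _ (hf i) IH).
Qed.

Lemma is_derive_mulmx n (X Y : K -> 'M[K]_n) (z : K) :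
  (forall i j, derivable (fun u => X u i j) z 1) ->
  (forall i j, derivable (fun u => Y u i j) z 1) ->
  forall i j, is_derive z (1 : K) (fun u => (X u *m Y u) i j)
    ((mxderive1 X z *m Y z + X z *m mxderive1 Y z) i j).
Proof.
move=> dX dY i j.
under eq_fun do rewrite mxE.
have -> : (mxderive1 X z *m Y z + X z *m mxderive1 Y z) i j =
    \sum_k (X z i k * derive1 (fun u => Y u k j) z +
            Y z k j * derive1 (fun u => X u i k) z).
  rewrite mxE [X in X + _]mxE [X in _ + X]mxE -big_split; apply: eq_bigr => k _.
  by rewrite !mxderive1E [RHS]addrC; congr (_ + _); exact: mulrC.
apply: is_derive_fun_sum => k.
exact: (@is_deriveM _ _ _ _ _ _ _ _ (derivable_is_derive1 (dX i k))
  (derivable_is_derive1 (dY k j))).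
Qed.

Lemma is_derive_linmx n (x : K) (X Y : K -> 'M[K]_n) (z : K) :
  (forall i j, derivable (fun u => X u i j) z 1) ->
  (forall i j, derivable (fun u => Y u i j) z 1) ->
  forall i j, is_derive z (1 : K) (fun u => (x *: X u + Y u) i j)
    ((x *: mxderive1 X z + mxderive1 Y z) i j).
Proof.
move=> dX dY i j.
rewrite (_ : (fun u => _) = (fun u => x *: X u i j + Y u i j)); last first.
  by apply/funext => u; rewrite !mxE.
rewrite 2!mxE !mxderive1E.
exact: (@is_deriveD _ _ _ _ _ _ _ _ _
  (@is_deriveZ _ _ _ _ x _ _ _ (derivable_is_derive1 (dX i j)))
  (derivable_is_derive1 (dY i j))).
Qed.

Lemma is_derive_mxtrace n (X : K -> 'M[K]_n) (z : K) :
  (forall i j, derivable (fun u => X u i j) z 1) ->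
  is_derive z (1 : K) (fun u => \tr (X u)) (\tr (mxderive1 X z)).
Proof.
move=> dX; apply: is_derive_fun_sum => i; rewrite mxE.
exact: derivable_is_derive1.
Qed.

End MatrixDerivatives.

(** * Complex limits and curves in the complex plane *)

Section ComplexLimits.
Variable R : realType.
Notation C := (Cplx R).
Notation Re := (@complex.Re R).
Notation Im := (@complex.Im R).

Lemma normc_ge_Im (x : C) : (`|Im x|%:C : C) <= `|x|.
Proof.
rewrite normc_def lecR -sqrtr_sqr ler_wsqrtr //.
by rewrite lerDr sqr_ge0.
Qed.

Lemma normc_le_ReIm (x : C) : `|x| <= ((`|Re x| + `|Im x|)%:C : C).
Proof.
rewrite normc_def lecR -[leRHS]ger0_norm ?addr_ge0// -sqrtr_sqr.
rewrite ler_wsqrtr // sqrrD !real_normK ?num_real //.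
rewrite -addrA [_ *+ 2 + _]addrC addrA lerDl mulrn_wge0 // mulr_ge0 //.
Qed.

(** Velocities and path integrals are defined componentwise, holomorphy by the
    complex norm; this is the bridge between the two. *)
Lemma cvg_ReIm (T : Type) (F : set_system T) {FF : Filter F} (f : T -> C)
    (l : C) :
  f @ F --> l <-> (Re \o f @ F --> Re l /\ Im \o f @ F --> Im l).
Proof.
split.
  move=> /cvgrPdist_lt cf; split; apply/cvgrPdist_lt => e e0.
    have e0' : 0 < (e%:C : C) by rewrite ltcR.
    apply: filterS (cf _ e0') => x; rewrite -raddfB -ltcR /=.
    exact/le_lt_trans/normc_ge_Re.
  have e0' : 0 < (e%:C : C) by rewrite ltcR.
  apply: filterS (cf _ e0') => x; rewrite -raddfB -ltcR /=.
  exact/le_lt_trans/normc_ge_Im.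
move=> [/cvgrPdist_lt cr /cvgrPdist_lt ci]; apply/cvgrPdist_lt => e.
rewrite ltcE /= => /andP[/eqP ei e0].
have e20 : 0 < Re e / 2 by rewrite divr_gt0.
near=> x.
apply: le_lt_trans (normc_le_ReIm _) _.
rewrite ltcE /= ei eqxx /=.
rewrite (splitr (Re e)) ltrD //; rewrite raddfB /=; near: x;
  [exact: cr|exact: ci].
Unshelve. all: by end_near. Qed.

(** Neither the real nor the complex chain rule applies, [z] being a curve over
    the reals and [f] differentiable over the complex numbers.  But
    [f (z s) - f (z t) = g (z s) * (z s - z t)] with [g] continuous can be
    divided by the real increment [s - t], and its limit read off in each
    component. *)
Lemma is_derive_holo_curve (f : C -> C) (z : R -> C) (t : R) :
  derivable f (z t) 1 ->
  derivable (fun s => Re (z s)) t 1 -> derivable (fun s => Im (z s)) t 1 ->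
  let v := derive1 f (z t) *
    Complex (derive1 (fun s => Re (z s)) t) (derive1 (fun s => Im (z s)) t) in
  is_derive t (1 : R) (fun s => Re (f (z s))) (Re v) /\
  is_derive t (1 : R) (fun s => Im (f (z s))) (Im v).
Proof.
move=> df dx dy v.
have [g [gc gE fE]] := caratheodory df.
have cx : {for t, continuous (fun s => Re (z s))} := derivable1_continuous dx.
have cy : {for t, continuous (fun s => Im (z s))} := derivable1_continuous dy.
have zc : {for t, continuous z} by apply/cvg_ReIm.
move: dx dy; rewrite !derivable1E => dx dy.
pose q h : C := Complex (h^-1 * (Re (z (h + t)) - Re (z t)))
                    (h^-1 * (Im (z (h + t)) - Im (z t))).
pose w := derive1 f (z t) ; rewrite -/w in v *.
have qc : q @ 0^' --> (Complex (derive1 (fun s => Re (z s)) t)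
                               (derive1 (fun s => Im (z s)) t) : C).
  apply/cvg_ReIm; split => /=; [exact: dx | exact: dy].
have gzc : (fun h => g (z (h + t))) @ 0^' --> w.
  by rewrite /w -gE; exact: (cvg_dnbhs0_shift (continuous_comp zc gc)).
have /(_ _)/cvg_ReIm[cr ci] := cvgM gzc qc.
have E h : h != 0 -> f (z (h + t)) - f (z t) = h%:C * (g (z (h + t)) * q h).
  move=> h0; rewrite fE mulrCA; congr (_ * _).
  rewrite /q; apply/eqP; rewrite eq_complex /=.
  by rewrite !mul0r subr0 addr0 !mulrA !divff // !mul1r !raddfB !eqxx.
have EE h : h != 0 -> Complex (h^-1 * (Re (f (z (h + t))) - Re (f (z t))))
    (h^-1 * (Im (f (z (h + t))) - Im (f (z t)))) = g (z (h + t)) * q h.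
  move=> h0; apply/eqP; rewrite eq_complex -!raddfB E //=.
  case: (g _ * q h) => a b /=.
  by rewrite !mul0r subr0 addr0 !mulrA !mulVf // !mul1r !eqxx.
split; apply: is_derive1_cvg.
- apply: cvg_trans cr; apply: near_eq_cvg; near=> h.
  by rewrite /= -EE //; near: h; exact: nbhs_dnbhs_neq.
- apply: cvg_trans ci; apply: near_eq_cvg; near=> h.
  by rewrite /= -EE //; near: h; exact: nbhs_dnbhs_neq.
Unshelve. all: by end_near. Qed.

End ComplexLimits.

(** * Forms on a Riemann surface and their integrals along curves *)

(** The real and the imaginary part of [x * u + v] both have this shape. *)
Lemma Rintegral_linear d (T : measurableType d) (R : realType)
    (mu : {measure set T -> \bar R}) (D : set T) (a b : R) (f g h : T -> R) :
  measurable D -> mu.-integrable D (EFin \o f) ->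
  mu.-integrable D (EFin \o g) -> mu.-integrable D (EFin \o h) ->
  \int[mu]_(t in D) (a * f t + b * g t + h t) =
  a * \int[mu]_(t in D) f t + b * \int[mu]_(t in D) g t + \int[mu]_(t in D) h t.
Proof.
move=> mD fi gi hi.
have iZ (r : R) (k : T -> R) : mu.-integrable D (EFin \o k) ->
    mu.-integrable D (EFin \o (fun t => r * k t)).
  by move=> ki; exact: (integrableZl mD r ki).
have afi := iZ a f fi; have bgi := iZ b g gi.
have abi : mu.-integrable D (EFin \o (fun t => a * f t + b * g t)).
  exact: (integrableD mD afi bgi).
by rewrite (RintegralD mD abi hi) (RintegralD mD afi bgi) !RintegralZl.
Qed.

Section Charts.
Variable R : realType.
Notation C := (Cplx R).
Notation Re := (@complex.Re R).
Notation Im := (@complex.Im R).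

Lemma holo_at_derivable (f : C -> C) (z : C) : holo_at f z -> derivable f z 1.
Proof. by move=> /nbhs_singleton[]. Qed.

Lemma holo_at_derive1_continuous (f : C -> C) (z : C) :
  holo_at f z -> {for z, continuous (derive1 f)}.
Proof. by move=> /nbhs_singleton[]. Qed.

Lemma C1_at_derivable (f : R -> R) (t : R) : C1_at f t -> derivable f t 1.
Proof. by move=> /nbhs_singleton[]. Qed.

Lemma C1_at_derive1_continuous (f : R -> R) (t : R) :
  C1_at f t -> {for t, continuous (derive1 f)}.
Proof. by move=> /nbhs_singleton[]. Qed.

Lemma paramK (S : topologicalType) (c : chart R S) (p : S) :
  dom c p -> \forall z \near coord c p,
    dom c (param c z) /\ coord c (param c z) = z.
Proof.
move=> cp; have : nbhs (coord c p) (coord c @` dom c).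
  by apply: open_nbhs_nbhs; split; [exact: img_open|exists p].
by apply: filterS => z [q cq <-]; rewrite (coordK cq).
Qed.

Variable S : riemann_surface R.
Implicit Types (c d : chart R S) (p : S) (A : set S) (eta : form S).

Lemma transition_holo c d p : atlas c -> atlas d -> dom c p -> dom d p ->
  holo_at (transition c d) (coord c p).
Proof. by move=> ac ad cp dp; have [] := atlas_compatible ac ad cp dp. Qed.

Lemma transition_coord c d p : dom c p -> transition c d (coord c p) = coord d p.
Proof. by move=> cp; rewrite /transition /= coordK. Qed.

(** The two properties that path integrals need: the transformation law makes
    the integrand independent of charts, and continuity makes it integrable. *)
Definition continuous_form_on A eta : Prop :=
  (forall c d p, A p -> atlas c -> atlas d -> dom c p -> dom d p ->
     eta c p = eta d p * derive1 (transition c d) (coord c p)) /\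
  (forall c p, A p -> atlas c -> dom c p ->
     {for coord c p, continuous (eta c \o param c)}).

Definition differential (F : S -> C) : form S :=
  fun c p => derive1 (fun z => F (param c z)) (coord c p).

Lemma near_dom_param c d p : dom c p -> dom d p ->
  \forall z \near coord c p, dom d (param c z).
Proof.
move=> cp dp; have : {for coord c p, continuous (param c)}.
  by apply: param_continuous; exists p.
rewrite /prop_for /continuous_at coordK //; apply.
by apply: open_nbhs_nbhs; split => //; exact: dom_open.
Qed.

(** Near [coord c p], [F] read in [c] is [F] read in [d] composed with the
    transition map, so the transformation law is the chain rule. *)
Lemma continuous_differential A (F : S -> C) :
  (forall p, A p -> fun_holo_at F p) -> continuous_form_on A (differential F).
Proof.
move=> hF; split=> [c d p Ap ac ad cp dp|c p Ap ac cp].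
- have hcd := holo_at_derivable (transition_holo ac ad cp dp).
  have := holo_at_derivable (hF p Ap d ad dp).
  rewrite -(transition_coord d cp) => hFd.
  have [_ H] := is_derive1_comp_field hcd hFd.
  rewrite (transition_coord d cp) in H.
  rewrite /differential -H derive1E; apply: near_eq_derive.
  near=> z; rewrite /= /transition /= coordK //.
  by near: z; exact: near_dom_param.
- have := holo_at_derive1_continuous (hF p Ap c ac cp).
  apply: near_eq_continuous; apply: filterS (paramK cp) => z [_ cz].
  by rewrite /differential /= cz.
Unshelve. all: by end_near. Qed.

Definition integrand (gam : R -> S) eta (t : R) : C :=
  let c := chart_at (gam t) in eta c (gam t) * velocity c gam t.

Section Curve.
Variables (A : set S) (gam : R -> S).
Hypothesis gamC1 : C1_path gam.
Hypothesis gamA : forall t : R, 0 <= t <= 1 -> A (gam t).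

Lemma chart_atP p : atlas (chart_at p) /\ dom (chart_at p) p.
Proof. by rewrite /chart_at; case: cid. Qed.

Lemma near_dom_curve c t : 0 <= t <= 1 -> dom c (gam t) ->
  \forall s \near t, dom c (gam s).
Proof.
move=> t01 ct; have [gc _] := gamC1 t01; apply: gc.
by apply: open_nbhs_nbhs; split => //; exact: dom_open.
Qed.

Lemma coord_curve_derivable c t : 0 <= t <= 1 -> atlas c -> dom c (gam t) ->
  derivable (fun s => Re (coord c (gam s))) t 1 /\
  derivable (fun s => Im (coord c (gam s))) t 1.
Proof.
move=> t01 ac ct; have [_ /(_ c ac ct)[hr hi]] := gamC1 t01.
exact: (conj (C1_at_derivable hr) (C1_at_derivable hi)).
Qed.

Lemma velocity_continuous c t : 0 <= t <= 1 -> atlas c -> dom c (gam t) ->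
  {for t, continuous (velocity c gam)}.
Proof.
move=> t01 ac ct; have [_ /(_ c ac ct)[hr hi]] := gamC1 t01.
apply/cvg_ReIm.
exact: (conj (C1_at_derive1_continuous hr) (C1_at_derive1_continuous hi)).
Qed.

Lemma velocity_transition c d t : 0 <= t <= 1 -> atlas c -> atlas d ->
  dom c (gam t) -> dom d (gam t) ->
  velocity d gam t =
    derive1 (transition c d) (coord c (gam t)) * velocity c gam t.
Proof.
move=> t01 ac ad ct dt.
have hcd := holo_at_derivable (transition_holo ac ad ct dt).
have [dx dy] := coord_curve_derivable t01 ac ct.
have [hr hi] := @is_derive_holo_curve R _ (fun s => coord c (gam s)) _ hcd dx dy.
rewrite -/(velocity c gam t) in hr hi.
have E : \forall s \near t, transition c d (coord c (gam s)) = coord d (gam s).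
  by apply: filterS (near_dom_curve t01 ct) => s cs; exact: transition_coord.
apply/eqP; rewrite eq_complex /=; apply/andP; split; apply/eqP; rewrite derive1E.
- have [_ <-] := hr; apply: near_eq_derive.
  by apply: filterS E => s /= ->.
- have [_ <-] := hi; apply: near_eq_derive.
  by apply: filterS E => s /= ->.
Qed.

(** The derivative of the transition map enters the coefficient of the form and
    the velocity inversely.  Thanks to this one chart can be kept around a given
    time, whereas [chart_at (gam t)] may jump with [t]. *)
Lemma integrandE eta c t : continuous_form_on A eta -> 0 <= t <= 1 ->
  atlas c -> dom c (gam t) ->
  integrand gam eta t = eta c (gam t) * velocity c gam t.
Proof.
move=> [he _] t01 ac ct; rewrite /integrand.
have [ad dt] := chart_atP (gam t).
rewrite (he _ _ _ (gamA t01) ad ac dt ct) -mulrA; congr (_ * _).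
by rewrite -(velocity_transition t01 ad ac dt ct).
Qed.

(** In a fixed chart the integrand is a product of continuous functions. *)
Lemma integrand_continuous eta : continuous_form_on A eta ->
  {within `[0%R, 1%R], continuous (Re \o integrand gam eta)} /\
  {within `[0%R, 1%R], continuous (Im \o integrand gam eta)}.
Proof.
move=> he.
suff H (t : R) : 0 <= t <= 1 ->
    integrand gam eta @ within `[0%R, 1%R] (nbhs t) --> integrand gam eta t.
  split; apply/subspace_continuousP => t /=; rewrite in_itv /= => t01.
    by have /cvg_ReIm[] := H t t01.
  by have /cvg_ReIm[] := H t t01.
move=> t01; have [ac ct] := chart_atP (gam t); set c := chart_at _ in ac ct.
have [gc _] := gamC1 t01.
have zc : {for t, continuous (coord c \o gam)}.
  by apply: continuous_comp => //; exact: coord_continuous.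
have ec : {for t, continuous ((eta c \o param c) \o (coord c \o gam))}.
  exact: (continuous_comp zc (he.2 _ _ (gamA t01) ac ct)).
have Gc : {for t, continuous (fun s => eta c (gam s) * velocity c gam s)}.
  apply: near_eq_continuous (cvgM ec (velocity_continuous t01 ac ct)).
  by apply: filterS (near_dom_curve t01 ct) => s cs; rewrite /= (coordK cs).
rewrite (integrandE he t01 ac ct).
pose G s := eta c (gam s) * velocity c gam s; rewrite -/G in Gc.
have GW : G @ within `[0%R, 1%R] (nbhs t) --> G t by apply: cvg_within_filter Gc.
rewrite -/(G t); apply: cvg_trans GW; apply: near_eq_cvg; near=> s.
have s01 : 0 <= s <= 1.
  have : `[0%R, 1%R]%classic s by near: s; exact: withinT.
  by rewrite /= in_itv.
have cs : dom c (gam s).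
  by near: s; apply: cvg_within; exact: near_dom_curve.
by rewrite (integrandE he s01 ac cs).
Unshelve. all: by end_near. Qed.

Lemma integrand_integrable eta : continuous_form_on A eta ->
  (@lebesgue_measure R).-integrable `[0%R, 1%R]
    (EFin \o (Re \o integrand gam eta)) /\
  (@lebesgue_measure R).-integrable `[0%R, 1%R]
    (EFin \o (Im \o integrand gam eta)).
Proof.
move=> /integrand_continuous[cr ci].
by split; apply: continuous_compact_integrable => //; exact: segment_compact.
Qed.

Lemma path_integralE eta : path_integral gam eta =
  Complex (\int[lebesgue_measure]_(t in `[0%R, 1%R]) Re (integrand gam eta t))
          (\int[lebesgue_measure]_(t in `[0%R, 1%R]) Im (integrand gam eta t)).
Proof. by []. Qed.

Lemma eq_path_integral eta eta' :
  (forall c p, A p -> atlas c -> dom c p -> eta c p = eta' c p) ->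
  path_integral gam eta = path_integral gam eta'.
Proof.
move=> H; rewrite !path_integralE.
have E t : t \in `[0%R, 1%R]%classic -> integrand gam eta t = integrand gam eta' t.
  rewrite inE /= in_itv /= => t01; rewrite /integrand.
  by have [ac ct] := chart_atP (gam t); rewrite (H _ _ (gamA t01) ac ct).
by congr Complex; apply: eq_Rintegral => t t01; rewrite E.
Qed.

Lemma path_integral_linear (x : C) eta eta' :
  continuous_form_on A eta -> continuous_form_on A eta' ->
  path_integral gam (fun c p => x * eta c p + eta' c p) =
  x * path_integral gam eta + path_integral gam eta'.
Proof.
move=> /integrand_integrable[er ei] /integrand_integrable[er' ei'].
have mI := @measurable_itv R `[0%R, 1%R].
have E t : integrand gam (fun c p => x * eta c p + eta' c p) t =
    x * integrand gam eta t + integrand gam eta' t.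
  by rewrite /integrand mulrDl mulrA.
have L := fun a b f h k => @Rintegral_linear _ _ _ (@lebesgue_measure R) _ a b f h k mI.
rewrite !path_integralE; apply/eqP; rewrite eq_complex; apply/andP; split; apply/eqP.
- transitivity (Re x *
       \int[lebesgue_measure]_(t in `[0%R, 1%R]) Re (integrand gam eta t) +
     (- Im x) *
       \int[lebesgue_measure]_(t in `[0%R, 1%R]) Im (integrand gam eta t) +
     \int[lebesgue_measure]_(t in `[0%R, 1%R]) Re (integrand gam eta' t)).
    rewrite -L //; apply: eq_Rintegral => t _; rewrite E mulNr.
    by case: (x) (integrand gam eta t) (integrand gam eta' t) => [? ?] [? ?] [? ?].
  by case: (x) => ? ?; rewrite /= mulNr.
- transitivity (Re x *
       \int[lebesgue_measure]_(t in `[0%R, 1%R]) Im (integrand gam eta t) +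
     Im x *
       \int[lebesgue_measure]_(t in `[0%R, 1%R]) Re (integrand gam eta t) +
     \int[lebesgue_measure]_(t in `[0%R, 1%R]) Im (integrand gam eta' t)).
    rewrite -L //; apply: eq_Rintegral => t _; rewrite E.
    by case: (x) (integrand gam eta t) (integrand gam eta' t) => [? ?] [? ?] [? ?].
  by case: (x) => ? ?.
Qed.

(** In a fixed chart the integrand is the derivative of [F] along the curve, to
    which the fundamental theorem of calculus applies component by component. *)
Lemma path_integral_differential (F : S -> C) :
  (forall p, A p -> fun_holo_at F p) ->
  path_integral gam (differential F) = F (gam 1) - F (gam 0).
Proof.
move=> hF; have cF := continuous_differential hF.
have [cr ci] := integrand_continuous cF.
have dF (t : R) : 0 <= t <= 1 ->
    is_derive t (1 : R) (fun s => Re (F (gam s)))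
      (Re (integrand gam (differential F) t)) /\
    is_derive t (1 : R) (fun s => Im (F (gam s)))
      (Im (integrand gam (differential F) t)).
  move=> t01; have := chart_atP (gam t); set c := chart_at _ => -[ac ct].
  have hFc := holo_at_derivable (hF _ (gamA t01) _ ac ct).
  have [dx dy] := coord_curve_derivable t01 ac ct.
  have [hr hi] :=
    @is_derive_holo_curve R _ (fun s => coord c (gam s)) _ hFc dx dy.
  have E : \forall s \near t, F (param c (coord c (gam s))) = F (gam s).
    by apply: filterS (near_dom_curve t01 ct) => s cs; rewrite coordK.
  split.
  - by apply: near_eq_is_derive hr; apply: filterS E => s /= ->.
  - by apply: near_eq_is_derive hi; apply: filterS E => s /= ->.
have ftc (f h : R -> R) : {within `[0%R, 1%R], continuous f} ->
    (forall t : R, 0 <= t <= 1 -> is_derive t (1 : R) h (f t)) ->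
    \int[lebesgue_measure]_(t in `[0%R, 1%R]) f t = h 1 - h 0.
  move=> fc hf.
  have hc (t : R) : 0 <= t <= 1 -> {for t, continuous h}.
    by move=> /hf[dh _]; exact: derivable1_continuous.
  rewrite /Rintegral (@continuous_FTC2 _ f h) //.
  - split.
    + move=> t; rewrite in_itv /= => /andP[t0 t1].
      have t01 : 0 <= t <= 1 by rewrite !ltW.
      by have [] := hf t t01.
    + by apply: cvg_at_right_filter; apply: hc; rewrite lexx ler01.
    + by apply: cvg_at_left_filter; apply: hc; rewrite lexx ler01.
  - move=> t; rewrite in_itv /= => /andP[t0 t1].
    have t01 : 0 <= t <= 1 by rewrite !ltW.
    by rewrite derive1E; have [_ ->] := hf t t01.
rewrite path_integralE.
rewrite (ftc _ (fun s => Re (F (gam s))) cr (fun t t01 => (dF t t01).1)).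
rewrite (ftc _ (fun s => Im (F (gam s))) ci (fun t t01 => (dF t t01).2)).
by case: (F (gam 1)) (F (gam 0)) => [? ?] [? ?].
Qed.

End Curve.

Section Cycle.
Variables (A : set S) (Z : chain S).
Hypothesis hZ : differentiable_cycle A Z.

Lemma eq_chain_integral eta eta' :
  (forall c p, A p -> atlas c -> dom c p -> eta c p = eta' c p) ->
  chain_integral Z eta = chain_integral Z eta'.
Proof.
move=> H; apply: eq_bigr => i _; congr (_ *~ _).
have [gC gA] := hZ.1 i; exact (eq_path_integral gA H).
Qed.

Lemma chain_integral_linear (x : C) eta eta' :
  continuous_form_on A eta -> continuous_form_on A eta' ->
  chain_integral Z (fun c p => x * eta c p + eta' c p) =
  x * chain_integral Z eta + chain_integral Z eta'.
Proof.
move=> he he'; rewrite /chain_integral mulr_sumr -big_split /=.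
apply: eq_bigr => i _; have [gC gA] := hZ.1 i.
by rewrite (path_integral_linear gC gA) // mulrzDl mulrzAr.
Qed.

(** The integral is the sum of the values of [F] weighted by the boundary of the
    chain, which is zero.  To make the weights appear, each end value is written
    as a combination of Kronecker symbols over the finite set of end points. *)
Lemma chain_integral_differential (F : S -> C) :
  (forall p, A p -> fun_holo_at F p) ->
  chain_integral Z (differential F) = 0.
Proof.
move=> hF.
pose e := undup ([seq simplex i 1 | i <- enum 'I_(nb_paths Z)] ++
                 [seq simplex i 0 | i <- enum 'I_(nb_paths Z)]).
have FE q : q \in e -> F q = \sum_(p <- e) F p * ((q == p)%:R : int)%:~R.
  move=> qe; rewrite (bigD1_seq q) ?undup_uniq //= eqxx mulr1 big1 ?addr0 //.
  by move=> p; rewrite eq_sym => /negbTE ->; rewrite mulr0.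
transitivity (\sum_(i < nb_paths Z) \sum_(p <- e) F p *
   (mult i * ((simplex i 1 == p)%:R - (simplex i 0 == p)%:R))%:~R).
  apply: eq_bigr => i _; have [gC gA] := hZ.1 i.
  have e1 : simplex i 1 \in e.
    rewrite mem_undup mem_cat; apply/orP; left.
    by apply/mapP; exists i; rewrite ?mem_enum.
  have e0 : simplex i 0 \in e.
    rewrite mem_undup mem_cat; apply/orP; right.
    by apply/mapP; exists i; rewrite ?mem_enum.
  rewrite (path_integral_differential gC gA hF) (FE _ e1) (FE _ e0) -sumrB.
  rewrite -mulrzl mulr_sumr; apply: eq_bigr => p _.
  by rewrite intrM rmorphB /= -mulrBr mulrCA.
rewrite exchange_big big1 // => p _ /=.
by rewrite -mulr_sumr -rmorph_sum /= hZ.2 mulr0.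
Qed.

End Cycle.
End Charts.

(** * Sums and products of holomorphic functions *)

Section HolomorphicClosure.
Variable R : realType.
Notation C := (Cplx R).

(** The derivative of a product is a formula in [f], [g] and their derivatives
    only where both are differentiable, so its continuity at a point uses
    differentiability in a whole neighbourhood. *)
Lemma near_holo_at (f : C -> C) (z : C) :
  holo_at f z -> \forall w \near z, holo_at f w.
Proof. exact: near_join. Qed.

Lemma holo_atD (f g : C -> C) (z : C) :
  holo_at f z -> holo_at g z -> holo_at (fun w => f w + g w) z.
Proof.
move=> hf hg; apply: filterS2 (near_holo_at hf) (near_holo_at hg) => w fw gw.
have D u : holo_at f u -> holo_at g u ->
    is_derive u (1 : C) (fun w => f w + g w) (derive1 f u + derive1 g u).
  move=> /holo_at_derivable df /holo_at_derivable dg.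
  exact: (@is_deriveD _ _ _ f g _ _ _ _ (derivable_is_derive1 df)
      (derivable_is_derive1 dg)).
split; first by have [] := D w fw gw.
apply: near_eq_continuous (continuousD (holo_at_derive1_continuous fw)
  (holo_at_derive1_continuous gw)).
apply: filterS2 (near_holo_at fw) (near_holo_at gw) => u fu gu.
by rewrite [RHS]derive1E; have [_ ->] := D u fu gu.
Qed.

Lemma holo_atM (f g : C -> C) (z : C) :
  holo_at f z -> holo_at g z -> holo_at (fun w => f w * g w) z.
Proof.
move=> hf hg; apply: filterS2 (near_holo_at hf) (near_holo_at hg) => w fw gw.
have D u : holo_at f u -> holo_at g u ->
    is_derive u (1 : C) (fun w => f w * g w) (f u * derive1 g u + g u * derive1 f u).
  move=> /holo_at_derivable df /holo_at_derivable dg.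
  exact: (@is_deriveM _ _ f g _ _ _ _ (derivable_is_derive1 df)
      (derivable_is_derive1 dg)).
split; first by have [] := D w fw gw.
have fc := derivable1_continuous (holo_at_derivable fw).
have gc := derivable1_continuous (holo_at_derivable gw).
apply: near_eq_continuous (continuousD
  (continuousM fc (holo_at_derive1_continuous gw))
  (continuousM gc (holo_at_derive1_continuous fw))).
apply: filterS2 (near_holo_at fw) (near_holo_at gw) => u fu gu.
by rewrite [RHS]derive1E; have [_ ->] := D u fu gu.
Qed.

Lemma holo_at_cst (k z : C) : holo_at (fun=> k) z.
Proof.
have H (w : C) : derivable (fun=> k) w (1 : C) /\
    {for w, continuous (derive1 (fun=> k))}.
  split; first exact: derivable_cst.
  have -> : derive1 (fun=> k) = fun=> 0.
    by apply/funext => u; exact: derive1_cst.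
  exact: (@cst_continuous C C 0 w).
by apply: filterS filterT => w _; exact: H.
Qed.

Lemma holo_at_sum (I : finType) (f : I -> C -> C) (z : C) :
  (forall i, holo_at (f i) z) -> holo_at (fun w => \sum_i f i w) z.
Proof.
move=> hf; elim: (index_enum I) => [|i s IH].
  by under eq_fun do rewrite big_nil; exact: holo_at_cst.
by under eq_fun do rewrite big_cons; exact: (holo_atD (hf i) IH).
Qed.

End HolomorphicClosure.

(** * Trace identities *)

Section TraceIdentities.
Variables (K : comNzRingType) (n : nat).
Implicit Types A B X Y Z W : 'M[K]_n.

Definition commx X Y := X *m Y - Y *m X.

Let mxtraceN X : \tr (- X) = - \tr X.
Proof. exact: raddfN. Qed.

Let mxtraceB X Y : \tr (X - Y) = \tr X - \tr Y.
Proof. exact: raddfB. Qed.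

Lemma mxtrace_commx X Y : \tr (commx X Y) = 0.
Proof. by rewrite /commx mxtraceB mxtrace_mulC subrr. Qed.

(** Invariance of the trace form under commutators. *)
Lemma mxtrace_mul_commx A W B : \tr (A *m commx W B) = \tr (W *m commx B A).
Proof.
rewrite /commx !mulmxBr !mxtraceB !mulmxA; congr (_ - _).
  by rewrite -mulmxA mxtrace_mulC.
by rewrite mxtrace_mulC mulmxA.
Qed.

Lemma commxN X Y : commx Y X = - commx X Y.
Proof. by rewrite /commx opprB. Qed.

Lemma commx_linr W (x : K) X Y :
  commx W (x *: X + Y) = x *: commx W X + commx W Y.
Proof.
by rewrite /commx mulmxDr mulmxDl -scalemxAr -scalemxAl opprD addrACA -scalerBr.
Qed.

(** By invariance the two terms in [W] are traces of [W] against opposite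
    commutators; what remains is the Leibniz rule. *)
Lemma mxtrace_commx_antisym W X Y dX dY :
  \tr (X *m (dY + commx W Y)) + \tr (Y *m (dX + commx W X)) =
  \tr (dX *m Y + X *m dY).
Proof.
rewrite (mulmxDr X dY) (mulmxDr Y dX) !mxtraceD.
rewrite (mxtrace_mul_commx X W Y) (mxtrace_mul_commx Y W X).
rewrite (commxN X Y) mulmxN mxtraceN.
by rewrite [\tr (Y *m dX)]mxtrace_mulC; ring.
Qed.

Lemma mxtrace_commx_change W W' X Y dY :
  \tr (X *m (dY + commx W Y)) - \tr (X *m (dY + commx W' Y)) =
  - \tr ((W - W') *m commx X Y).
Proof.
rewrite !(mulmxDr X dY) !mxtraceD.
rewrite (mxtrace_mul_commx X W Y) (mxtrace_mul_commx X W' Y).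
rewrite (commxN X Y) !mulmxN !mxtraceN.
by rewrite mulmxBl mxtraceB; ring.
Qed.

(** The Jacobi identity, paired with [W] so that it becomes an identity between
    scalars. *)
Lemma mxtrace_jacobi W X Y Z :
  \tr (W *m commx Z (commx X Y)) + \tr (W *m commx X (commx Y Z)) +
  \tr (W *m commx Y (commx Z X)) = 0.
Proof.
rewrite /commx !(mulmxBr, mulmxBl, mxtraceB, mulmxA).
by ring.
Qed.

(** By invariance the terms in [W] form a Jacobi sum, and the others are the
    Leibniz rule for the trace of [commx X Y *m Z]. *)
Lemma mxtrace_commx_cyclic W X Y Z dX dY dZ :
  \tr (commx X Y *m (dZ + commx W Z)) + \tr (commx Y Z *m (dX + commx W X)) +
  \tr (commx Z X *m (dY + commx W Y)) =
  \tr ((commx dX Y + commx X dY) *m Z + commx X Y *m dZ).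
Proof.
rewrite (mulmxDr _ dX) (mulmxDr _ dY) (mulmxDr _ dZ) (mulmxDl _ _ Z) !mxtraceD.
rewrite (mxtrace_mul_commx _ W Z) (mxtrace_mul_commx _ W X) (mxtrace_mul_commx _ W Y).
have -> : \tr (commx dX Y *m Z) = \tr (commx Y Z *m dX).
  by rewrite mxtrace_mulC mxtrace_mul_commx mxtrace_mulC.
have -> : \tr (commx X dY *m Z) = \tr (commx Z X *m dY).
  by rewrite mxtrace_mulC 2!mxtrace_mul_commx mxtrace_mulC.
rewrite -[RHS]addr0 -(mxtrace_jacobi W X Y Z).
by ring.
Qed.

End TraceIdentities.

(** * Matrix-valued functions and forms *)

Section MatrixForms.
Variable R : realType.
Notation C := (Cplx R).
Variables (S : riemann_surface R) (A : set S) (n : nat).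
Implicit Types (X Y L : S -> 'M[C]_n) (w : mxform S n).

Lemma continuous_formD (eta eta' : form S) :
  continuous_form_on A eta -> continuous_form_on A eta' ->
  continuous_form_on A (fun c p => eta c p + eta' c p).
Proof.
move=> [te ce] [te' ce']; split=> [c d p Ap ac ad cp dp|c p Ap ac cp].
  by rewrite (te c d p) // (te' c d p) // mulrDl.
exact: (continuousD (ce c p Ap ac cp) (ce' c p Ap ac cp)).
Qed.

Lemma continuous_formM (f : S -> C) (eta : form S) :
  (forall p, A p -> fun_holo_at f p) -> continuous_form_on A eta ->
  continuous_form_on A (fun c p => f p * eta c p).
Proof.
move=> hf [te ce]; split=> [c d p Ap ac ad cp dp|c p Ap ac cp].
  by rewrite (te c d p) // mulrA.
have fc := derivable1_continuous (holo_at_derivable (hf p Ap c ac cp)).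
exact: (continuousM fc (ce c p Ap ac cp)).
Qed.

Lemma continuous_form0 : continuous_form_on A (fun _ _ => 0).
Proof.
split=> [c d p _ _ _ _ _|c p _ _ _]; first by rewrite mul0r.
exact: (@cst_continuous C C 0 (coord c p)).
Qed.

Lemma continuous_form_sum (I : finType) (eta : I -> form S) :
  (forall i, continuous_form_on A (eta i)) ->
  continuous_form_on A (fun c p => \sum_i eta i c p).
Proof.
move=> he; elim: (index_enum I) => [|i s IH].
  rewrite (_ : (fun c p => _) = (fun _ _ => 0)); first exact: continuous_form0.
  by apply/funext => c; apply/funext => p; rewrite big_nil.
rewrite (_ : (fun c p => _) = (fun c p => eta i c p + \sum_(j <- s) eta j c p)).
  exact: continuous_formD (he i) IH.
by apply/funext => c; apply/funext => p; rewrite big_cons.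
Qed.

Definition mxholo_on X : Prop :=
  forall p, A p -> forall i j, fun_holo_at (fun q => X q i j) p.

Definition continuous_mxform_on w : Prop :=
  forall i j, continuous_form_on A (entry w i j).

Lemma mxholo_mul X Y : mxholo_on X -> mxholo_on Y ->
  mxholo_on (fun p => X p *m Y p).
Proof.
move=> hX hY p Ap i j c ac cp.
rewrite (_ : _ \o _ = (fun z => \sum_k (X (param c z) i k * Y (param c z) k j))).
  apply: holo_at_sum => k.
  exact: (holo_atM (hX p Ap i k c ac cp) (hY p Ap k j c ac cp)).
by apply/funext => z /=; rewrite mxE.
Qed.

Lemma mxholo_lin (x : C) X Y : mxholo_on X -> mxholo_on Y ->
  mxholo_on (fun p => x *: X p + Y p).
Proof.
move=> hX hY p Ap i j c ac cp.
rewrite (_ : _ \o _ = (fun z => x * X (param c z) i j + Y (param c z) i j)).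
  exact: (holo_atD (holo_atM (holo_at_cst x _) (hX p Ap i j c ac cp))
    (hY p Ap i j c ac cp)).
by apply/funext => z /=; rewrite !mxE.
Qed.

Lemma holo_mxtrace X : mxholo_on X ->
  forall p, A p -> fun_holo_at (fun q => \tr (X q)) p.
Proof.
move=> hX p Ap c ac cp.
by apply: holo_at_sum => i; exact: (hX p Ap i i c ac cp).
Qed.

Definition mxdifferential X : mxform S n :=
  fun c p => mxderive1 (fun z => X (param c z)) (coord c p).

Lemma continuous_mxdifferential X :
  mxholo_on X -> continuous_mxform_on (mxdifferential X).
Proof.
move=> hX i j.
rewrite (_ : entry _ i j = differential (fun q => X q i j)).
  by apply: continuous_differential => p Ap; exact: hX.
apply/funext => c; apply/funext => p.
by rewrite /entry /mxdifferential mxderive1E.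
Qed.

Lemma continuous_mxform_mulmxl X w : mxholo_on X -> continuous_mxform_on w ->
  continuous_mxform_on (fun c p => X p *m w c p).
Proof.
move=> hX hw i j.
rewrite (_ : entry _ i j = (fun c p => \sum_k (X p i k * entry w k j c p))).
  apply: continuous_form_sum => k.
  by apply: continuous_formM (hw k j) => p Ap; exact: hX.
by apply/funext => c; apply/funext => p; rewrite /entry mxE.
Qed.

Lemma continuous_mxform_mulmxr X w : mxholo_on X -> continuous_mxform_on w ->
  continuous_mxform_on (fun c p => w c p *m X p).
Proof.
move=> hX hw i j.
rewrite (_ : entry _ i j = (fun c p => \sum_k (X p k j * entry w i k c p))).
  apply: continuous_form_sum => k.
  by apply: continuous_formM (hw i k) => p Ap; exact: hX.
apply/funext => c; apply/funext => p; rewrite /entry mxE.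
by apply: eq_bigr => k _; exact: mulrC.
Qed.

Lemma continuous_mxform_lin (x : C) w w' :
  continuous_mxform_on w -> continuous_mxform_on w' ->
  continuous_mxform_on (fun c p => x *: w c p + w' c p).
Proof.
move=> hw hw' i j.
rewrite (_ : entry _ i j = (fun c p => x * entry w i j c p + entry w' i j c p)).
  apply: continuous_formD (hw' i j); apply: continuous_formM (hw i j) => p _.
  by move=> c _ _; exact: holo_at_cst.
by apply/funext => c; apply/funext => p; rewrite /entry !mxE.
Qed.

Lemma continuous_mxformB w w' :
  continuous_mxform_on w -> continuous_mxform_on w' ->
  continuous_mxform_on (fun c p => w c p - w' c p).
Proof.
move=> hw hw'; have := continuous_mxform_lin (-1) hw' hw.
by congr continuous_mxform_on; apply/funext => c; apply/funext => p;
  rewrite scaleN1r addrC.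
Qed.

Lemma continuous_form_mxtrace w : continuous_mxform_on w ->
  continuous_form_on A (fun c p => \tr (w c p)).
Proof. by move=> hw; apply: continuous_form_sum => i; exact: hw. Qed.

Lemma mxholo_derivable X c p : mxholo_on X -> A p -> atlas c -> dom c p ->
  forall i j, derivable (fun z => X (param c z) i j) (coord c p) 1.
Proof.
by move=> hX Ap ac cp i j; exact: (holo_at_derivable (hX p Ap i j c ac cp)).
Qed.

Lemma mxdifferential_mul X Y c p : mxholo_on X -> mxholo_on Y ->
  A p -> atlas c -> dom c p ->
  mxdifferential (fun q => X q *m Y q) c p =
  mxdifferential X c p *m Y p + X p *m mxdifferential Y c p.
Proof.
move=> hX hY Ap ac cp; apply/matrixP => i j.
rewrite /mxdifferential mxderive1E derive1E.
have [_ ->] := is_derive_mulmx (mxholo_derivable hX Ap ac cp)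
  (mxholo_derivable hY Ap ac cp) i j.
by rewrite (coordK cp).
Qed.

Lemma mxdifferential_lin (x : C) X Y c p : mxholo_on X -> mxholo_on Y ->
  A p -> atlas c -> dom c p ->
  mxdifferential (fun q => x *: X q + Y q) c p =
  x *: mxdifferential X c p + mxdifferential Y c p.
Proof.
move=> hX hY Ap ac cp; apply/matrixP => i j.
rewrite /mxdifferential mxderive1E derive1E.
have [_ ->] := is_derive_linmx x (mxholo_derivable hX Ap ac cp)
  (mxholo_derivable hY Ap ac cp) i j.
by [].
Qed.

Lemma differential_mxtrace X c p : mxholo_on X -> A p -> atlas c -> dom c p ->
  differential (fun q => \tr (X q)) c p = \tr (mxdifferential X c p).
Proof.
move=> hX Ap ac cp; rewrite /differential derive1E.
by have [_ ->] := is_derive_mxtrace (mxholo_derivable hX Ap ac cp).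
Qed.

End MatrixForms.

(** * The two pairings defined by a connection *)

Section Pairings.
Variable R : realType.
Notation C := (Cplx R).
Variables (S : riemann_surface R) (A : set S) (Z : chain S) (n : nat).
Hypothesis hZ : differentiable_cycle A Z.
Implicit Types (X Y T : S -> 'M[C]_n) (w : mxform S n) (eta : form S).

Notation I := (chain_integral Z).

Definition covariant w X : mxform S n :=
  fun c p => mxdifferential X c p + commx (w c p) (X p).

(** Up to the factor [1 / (2 pi i)], [pairing] and [trace_pairing] are the two
    geometric cocycles, extended to all matrix functions holomorphic on [A]:
    this domain is visibly closed under commutators. *)
Definition pairing w X Y : C := I (fun c p => \tr (X p *m covariant w Y c p)).

Definition trace_pairing w X Y : C :=
  I (fun c p => \tr (X p) * \tr (covariant w Y c p)).

Lemma chain_integralD eta eta' :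
  continuous_form_on A eta -> continuous_form_on A eta' ->
  I (fun c p => eta c p + eta' c p) = I eta + I eta'.
Proof.
move=> he he'; rewrite -[I eta]mul1r -(chain_integral_linear hZ 1 he he').
by congr chain_integral; apply/funext => c; apply/funext => p; rewrite mul1r.
Qed.

Lemma continuous_covariant w X : continuous_mxform_on A w -> mxholo_on A X ->
  continuous_mxform_on A (covariant w X).
Proof.
move=> hw hX.
have := continuous_mxform_lin 1 (continuous_mxdifferential hX)
  (continuous_mxform_lin (-1) (continuous_mxform_mulmxl hX hw)
    (continuous_mxform_mulmxr hX hw)).
congr continuous_mxform_on; apply/funext => c; apply/funext => p.
by rewrite scale1r scaleN1r addrC /covariant /commx [RHS]addrC [- _ + _]addrC.
Qed.

Lemma continuous_pairing w X Y :
  continuous_mxform_on A w -> mxholo_on A X -> mxholo_on A Y ->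
  continuous_form_on A (fun c p => \tr (X p *m covariant w Y c p)).
Proof.
move=> hw hX hY.
exact: continuous_form_mxtrace (continuous_mxform_mulmxl hX
  (continuous_covariant hw hY)).
Qed.

Lemma continuous_trace_pairing w X Y :
  continuous_mxform_on A w -> mxholo_on A X -> mxholo_on A Y ->
  continuous_form_on A (fun c p => \tr (X p) * \tr (covariant w Y c p)).
Proof.
move=> hw hX hY; apply: continuous_formM (holo_mxtrace hX) _.
exact: continuous_form_mxtrace (continuous_covariant hw hY).
Qed.

Lemma mxholo_commx X Y : mxholo_on A X -> mxholo_on A Y ->
  mxholo_on A (fun p => commx (X p) (Y p)).
Proof.
move=> hX hY.
have := mxholo_lin (-1) (mxholo_mul hY hX) (mxholo_mul hX hY).
by congr mxholo_on; apply/funext => p; rewrite scaleN1r addrC.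
Qed.

Lemma mxdifferential_commx X Y c p : mxholo_on A X -> mxholo_on A Y ->
  A p -> atlas c -> dom c p ->
  mxdifferential (fun q => commx (X q) (Y q)) c p =
  commx (mxdifferential X c p) (Y p) + commx (X p) (mxdifferential Y c p).
Proof.
move=> hX hY Ap ac cp.
rewrite (_ : (fun q => _) = (fun q => (-1) *: (Y q *m X q) + X q *m Y q)).
  rewrite (mxdifferential_lin _ (mxholo_mul hY hX) (mxholo_mul hX hY) Ap ac cp).
  rewrite (mxdifferential_mul hY hX Ap ac cp) (mxdifferential_mul hX hY Ap ac cp).
  by rewrite scaleN1r /commx addrC [RHS]addrACA -opprD [in RHS](addrC (Y p *m _)).
by apply/funext => q; rewrite scaleN1r addrC.
Qed.

Lemma covariant_lin w (x : C) X Y c p : mxholo_on A X -> mxholo_on A Y ->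
  A p -> atlas c -> dom c p ->
  covariant w (fun q => x *: X q + Y q) c p =
  x *: covariant w X c p + covariant w Y c p.
Proof.
move=> hX hY Ap ac cp.
rewrite /covariant (mxdifferential_lin x hX hY Ap ac cp) commx_linr.
by rewrite (scalerDr x (mxdifferential X c p)) addrACA.
Qed.

Lemma mxtrace_lin (x : C) (U V : 'M[C]_n) : \tr (x *: U + V) = x * \tr U + \tr V.
Proof. by rewrite mxtraceD mxtraceZ. Qed.

Lemma pairing_linl w (x : C) X X' Y : continuous_mxform_on A w ->
  mxholo_on A X -> mxholo_on A X' -> mxholo_on A Y ->
  pairing w (fun p => x *: X p + X' p) Y = x * pairing w X Y + pairing w X' Y.
Proof.
move=> hw hX hX' hY.
rewrite /pairing -(chain_integral_linear hZ x (continuous_pairing hw hX hY)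
  (continuous_pairing hw hX' hY)).
apply: (eq_chain_integral hZ) => c p Ap ac cp.
by rewrite mulmxDl -scalemxAl mxtrace_lin.
Qed.

Lemma pairing_linr w (x : C) X Y Y' : continuous_mxform_on A w ->
  mxholo_on A X -> mxholo_on A Y -> mxholo_on A Y' ->
  pairing w X (fun p => x *: Y p + Y' p) = x * pairing w X Y + pairing w X Y'.
Proof.
move=> hw hX hY hY'.
rewrite /pairing -(chain_integral_linear hZ x (continuous_pairing hw hX hY)
  (continuous_pairing hw hX hY')).
apply: (eq_chain_integral hZ) => c p Ap ac cp.
by rewrite (covariant_lin w x hY hY' Ap ac cp) mulmxDr -scalemxAr mxtrace_lin.
Qed.

Lemma chain_integral_exact eta X : mxholo_on A X ->
  (forall c p, A p -> atlas c -> dom c p ->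
     eta c p = \tr (mxdifferential X c p)) ->
  I eta = 0.
Proof.
move=> hX he; rewrite -(chain_integral_differential hZ (holo_mxtrace hX)).
apply: (eq_chain_integral hZ) => c p Ap ac cp.
by rewrite (he c p Ap ac cp) (differential_mxtrace hX Ap ac cp).
Qed.

(** The two integrands add up to the differential of the trace of [X *m Y]. *)
Lemma pairing_antisym w X Y : continuous_mxform_on A w ->
  mxholo_on A X -> mxholo_on A Y -> pairing w X Y = - pairing w Y X.
Proof.
move=> hw hX hY; apply/eqP; rewrite -addr_eq0; apply/eqP.
rewrite /pairing -(chain_integralD (continuous_pairing hw hX hY)
  (continuous_pairing hw hY hX)).
apply: (chain_integral_exact (mxholo_mul hX hY)) => c p Ap ac cp.
by rewrite (mxdifferential_mul hX hY Ap ac cp) mxtrace_commx_antisym.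
Qed.

(** The three integrands add up to the differential of the trace of
    [commx X Y *m T]. *)
Lemma pairing_cyclic w X Y T : continuous_mxform_on A w ->
  mxholo_on A X -> mxholo_on A Y -> mxholo_on A T ->
  pairing w (fun p => commx (X p) (Y p)) T +
  pairing w (fun p => commx (Y p) (T p)) X +
  pairing w (fun p => commx (T p) (X p)) Y = 0.
Proof.
move=> hw hX hY hT.
have hXY := mxholo_commx hX hY; have hYT := mxholo_commx hY hT.
have hTX := mxholo_commx hT hX.
have c1 := continuous_pairing hw hXY hT; have c2 := continuous_pairing hw hYT hX.
have c3 := continuous_pairing hw hTX hY.
rewrite /pairing -(chain_integralD c1 c2) -(chain_integralD (continuous_formD c1 c2) c3).
apply: (chain_integral_exact (mxholo_mul hXY hT)) => c p Ap ac cp.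
rewrite (mxdifferential_mul hXY hT Ap ac cp) (mxdifferential_commx hX hY Ap ac cp).
by rewrite mxtrace_commx_cyclic.
Qed.

Lemma pairing_change w w' X Y : continuous_mxform_on A w ->
  continuous_mxform_on A w' -> mxholo_on A X -> mxholo_on A Y ->
  pairing w X Y - pairing w' X Y =
  - I (fun c p => \tr ((w c p - w' c p) *m commx (X p) (Y p))).
Proof.
move=> hw hw' hX hY.
have hXY := mxholo_commx hX hY.
have cd : continuous_form_on A
    (fun c p => \tr ((w c p - w' c p) *m commx (X p) (Y p))).
  apply/continuous_form_mxtrace/(continuous_mxform_mulmxr hXY).
  exact: continuous_mxformB.
apply/eqP; rewrite -addr_eq0 addrAC subr_eq0 /pairing.
rewrite -(chain_integralD (continuous_pairing hw hX hY) cd); apply/eqP.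
apply: (eq_chain_integral hZ) => c p Ap ac cp.
apply/eqP; rewrite -subr_eq0 addrAC mxtrace_commx_change.
by rewrite addNr.
Qed.

Lemma mxtrace_covariant w X c p :
  \tr (covariant w X c p) = \tr (mxdifferential X c p).
Proof. by rewrite /covariant mxtraceD mxtrace_commx addr0. Qed.

Lemma trace_pairing_linl w (x : C) X X' Y : continuous_mxform_on A w ->
  mxholo_on A X -> mxholo_on A X' -> mxholo_on A Y ->
  trace_pairing w (fun p => x *: X p + X' p) Y =
  x * trace_pairing w X Y + trace_pairing w X' Y.
Proof.
move=> hw hX hX' hY.
rewrite /trace_pairing -(chain_integral_linear hZ x
  (continuous_trace_pairing hw hX hY) (continuous_trace_pairing hw hX' hY)).
apply: (eq_chain_integral hZ) => c p Ap ac cp.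
by rewrite mxtrace_lin mulrDl mulrA.
Qed.

Lemma differentialM (f g : S -> C) c p :
  fun_holo_at f p -> fun_holo_at g p -> atlas c -> dom c p ->
  differential (fun q => f q * g q) c p =
  f p * differential g c p + g p * differential f c p.
Proof.
move=> hf hg ac cp.
have df := derivable_is_derive1 (holo_at_derivable (hf c ac cp)).
have dg := derivable_is_derive1 (holo_at_derivable (hg c ac cp)).
have [_ E] := @is_deriveM _ _ _ _ _ _ _ _ df dg.
have fE : (f \o param c) (coord c p) = f p by rewrite /= (coordK cp).
have gE : (g \o param c) (coord c p) = g p by rewrite /= (coordK cp).
rewrite fE gE in E.
by rewrite [LHS]/differential derive1E; exact: E.
Qed.

Lemma chain_integral_by_parts (f g : S -> C) :
  (forall p, A p -> fun_holo_at f p) -> (forall p, A p -> fun_holo_at g p) ->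
  I (fun c p => f p * differential g c p) =
  - I (fun c p => g p * differential f c p).
Proof.
move=> hf hg; apply/eqP; rewrite -addr_eq0; apply/eqP.
rewrite -(chain_integralD (continuous_formM hf (continuous_differential hg))
  (continuous_formM hg (continuous_differential hf))).
have hfg p : A p -> fun_holo_at (fun q => f q * g q) p.
  by move=> Ap c ac cp; exact: (holo_atM (hf p Ap c ac cp) (hg p Ap c ac cp)).
rewrite -(chain_integral_differential hZ hfg).
apply: (eq_chain_integral hZ) => c p Ap ac cp.
by rewrite (differentialM (hf p Ap) (hg p Ap) ac cp).
Qed.

(** A commutator has trace zero, so the connection form disappears. *)
Lemma trace_pairingE w X Y : mxholo_on A Y -> trace_pairing w X Y =
  I (fun c p => \tr (X p) * differential (fun q => \tr (Y q)) c p).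
Proof.
move=> hY; apply: (eq_chain_integral hZ) => c p Ap ac cp; congr (_ * _).
exact: etrans (mxtrace_covariant w Y c p) (esym (differential_mxtrace hY Ap ac cp)).
Qed.

Lemma trace_pairing_antisym w X Y :
  mxholo_on A X -> mxholo_on A Y -> trace_pairing w X Y = - trace_pairing w Y X.
Proof.
move=> hX hY; rewrite (trace_pairingE w X hY) (trace_pairingE w Y hX).
exact: chain_integral_by_parts (holo_mxtrace hX) (holo_mxtrace hY).
Qed.

Lemma trace_pairing_linr w (x : C) X Y Y' : continuous_mxform_on A w ->
  mxholo_on A X -> mxholo_on A Y -> mxholo_on A Y' ->
  trace_pairing w X (fun p => x *: Y p + Y' p) =
  x * trace_pairing w X Y + trace_pairing w X Y'.
Proof.
move=> hw hX hY hY'.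
rewrite (trace_pairing_antisym w hX (mxholo_lin x hY hY')).
rewrite (trace_pairing_linl x hw hY hY' hX) opprD -mulrN.
by rewrite -(trace_pairing_antisym w hX hY) -(trace_pairing_antisym w hX hY').
Qed.

Lemma trace_pairing_commx w X Y T :
  trace_pairing w (fun p => commx (X p) (Y p)) T = 0.
Proof.
have h0 p : A p -> fun_holo_at (fun=> 0 : C) p.
  by move=> _ c _ _; exact: holo_at_cst.
rewrite -(chain_integral_differential hZ h0).
apply: (eq_chain_integral hZ) => c p _ _ _.
by rewrite mxtrace_commx mul0r /differential derive1_cst.
Qed.

Lemma trace_pairing_change w w' X Y : trace_pairing w X Y = trace_pairing w' X Y.
Proof.
apply: (eq_chain_integral hZ) => c p _ _ _.
have E := etrans (mxtrace_covariant w Y c p) (esym (mxtrace_covariant w' Y c p)).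
exact (congr1 (fun u : C => \tr (X p) * u) E).
Qed.

End Pairings.

(** * Cocycles on the Lax operator algebra *)

Section LaxCocycles.
Variables (R : realType) (S : riemann_surface R) (g n : nat).
Variables (D : lax_data S g n) (Z : chain S).
Hypothesis hZ : differentiable_cycle (~` marked D) Z.
Notation C := (Cplx R).
Notation K := (two_pi_i R)^-1.

Lemma lax_mxholo L : lax_algebra D L -> mxholo_on (~` marked D) L.
Proof. by case=> _ _ hL _ _. Qed.

(** The poles of a connection form lie among the marked points. *)
Lemma connection_continuous w : connection_form D w ->
  continuous_mxform_on (~` marked D) w.
Proof.
move=> [wform _ whol _ _] i j; split=> [c d p _|c p np ac cp].
  exact: wform.
apply: derivable1_continuous; apply: holo_at_derivable.
apply: (whol p _ _ i j c ac cp) => [pE|s pE]; apply: np.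
- exact: Or32.
- by apply: Or33; exists s.
Qed.

Lemma gamma1E w L L' : gamma1 D w Z L L' = K * pairing Z w L L'.
Proof. by []. Qed.

Lemma gamma2E w L L' : gamma2 D w Z L L' = K * trace_pairing Z w L L'.
Proof. by []. Qed.

Lemma gamma1_cocycle w : connection_form D w -> cocycle D (gamma1 D w Z).
Proof.
move=> /connection_continuous hw; split.
- move=> L /lax_mxholo hL x M M' /lax_mxholo hM /lax_mxholo hM'.
  by rewrite !gamma1E (pairing_linr hZ x hw hL hM hM') mulrDr mulrCA.
- move=> L /lax_mxholo hL x M M' /lax_mxholo hM /lax_mxholo hM'.
  by rewrite !gamma1E (pairing_linl hZ x hw hM hM' hL) mulrDr mulrCA.
- move=> L L' /lax_mxholo hL /lax_mxholo hL'.
  by rewrite !gamma1E (pairing_antisym hZ hw hL hL') mulrN.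
- move=> L L' L'' /lax_mxholo hL /lax_mxholo hL' /lax_mxholo hL''.
  rewrite !gamma1E -!mulrDr -[RHS](mulr0 K); congr (_ * _).
  exact: (pairing_cyclic hZ hw hL hL' hL'').
Qed.

Lemma gamma2_cocycle w : connection_form D w -> cocycle D (gamma2 D w Z).
Proof.
move=> /connection_continuous hw; split.
- move=> L /lax_mxholo hL x M M' /lax_mxholo hM /lax_mxholo hM'.
  by rewrite !gamma2E (trace_pairing_linr hZ x hw hL hM hM') mulrDr mulrCA.
- move=> L /lax_mxholo hL x M M' /lax_mxholo hM /lax_mxholo hM'.
  by rewrite !gamma2E (trace_pairing_linl hZ x hw hM hM' hL) mulrDr mulrCA.
- move=> L L' /lax_mxholo hL /lax_mxholo hL'.
  by rewrite !gamma2E (trace_pairing_antisym hZ w hL hL') mulrN.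
- move=> L L' L'' _ _ _.
  have E X Y T : gamma2 D w Z (bracket X Y) T = 0.
    by rewrite gamma2E; rewrite (trace_pairing_commx hZ w X Y T) mulr0.
  by rewrite !E !addr0.
Qed.

Lemma gamma2_indep w w' L L' : gamma2 D w Z L L' = gamma2 D w' Z L L'.
Proof. by rewrite !gamma2E (trace_pairing_change hZ w w'). Qed.

Lemma gamma1_change w w' L L' : connection_form D w -> connection_form D w' ->
  lax_algebra D L -> lax_algebra D L' ->
  gamma1 D w Z L L' - gamma1 D w' Z L L' =
  - (K * chain_integral Z
           (fun c p => \tr ((w c p - w' c p) *m bracket L L' p))).
Proof.
move=> /connection_continuous hw /connection_continuous hw'.
move=> /lax_mxholo hL /lax_mxholo hL'.
rewrite !gamma1E -mulrBr -mulrN; congr (_ * _).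
exact: (pairing_change hZ hw hw' hL hL').
Qed.

Lemma change_linear w w' : connection_form D w -> connection_form D w' ->
  linear_form (D := D) (fun L => - (K *
    chain_integral Z (fun c p => \tr ((w c p - w' c p) *m L p)))).
Proof.
move=> /connection_continuous hw /connection_continuous hw'.
move=> x L L' /lax_mxholo hL /lax_mxholo hL'.
have hd := continuous_mxformB hw hw'.
have cd T : mxholo_on (~` marked D) T ->
    continuous_form_on (~` marked D) (fun c p => \tr ((w c p - w' c p) *m T p)).
  by move=> hT; exact/continuous_form_mxtrace/(continuous_mxform_mulmxr hT hd).
rewrite mulrN -opprD mulrCA -mulrDr; congr (- (_ * _)).
rewrite -(chain_integral_linear hZ x (cd L hL) (cd L' hL')).
apply: (eq_chain_integral hZ) => c p _ _ _.
by rewrite /lin mulmxDr -scalemxAr mxtrace_lin.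
Qed.

Lemma coboundaryD ga ga' : coboundary (D := D) ga -> coboundary (D := D) ga' ->
  coboundary (D := D) (fun L L' => ga L L' + ga' L L').
Proof.
move=> [phi [lphi E]] [phi' [lphi' E']]; exists (fun L => phi L + phi' L); split.
- by move=> x L L' hL hL'; rewrite lphi // lphi' // mulrDr addrACA.
- by move=> L L' hL hL'; rewrite E // E'.
Qed.

(** The cochain whose coboundary this is pairs [L] with the difference of the
    two connection forms. *)
Lemma gamma1_change_coboundary w w' :
  connection_form D w -> connection_form D w' ->
  coboundary (D := D) (fun L L' => gamma1 D w Z L L' - gamma1 D w' Z L L').
Proof.
move=> hw hw'; exists (fun L => - (K *
  chain_integral Z (fun c p => \tr ((w c p - w' c p) *m L p)))).
split; first exact: change_linear.
by move=> L L' hL hL'; exact: gamma1_change.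
Qed.

Lemma H2_class_sub ga ga' :
  coboundary (D := D) (fun L L' => ga L L' - ga' L L') ->
  H2_class D ga `<=` H2_class D ga'.
Proof.
move=> h del [cdel hdel]; split => //.
have := coboundaryD hdel h; congr coboundary.
by apply/funext => L; apply/funext => L'; rewrite addrA subrK.
Qed.

End LaxCocycles.

Theorem proposition3p2 (R : realType) (S : riemann_surface R) (g n : nat)
    (D : lax_data S g n) (Z : chain S)
    (hg : has_genus S g)
    (hZ : differentiable_cycle (~` marked D) Z) :
  (forall w, connection_form D w -> cocycle D (gamma2 D w Z)) /\
  (forall w w', connection_form D w -> connection_form D w' ->
     forall L L', lax_algebra D L -> lax_algebra D L' ->
       gamma2 D w Z L L' = gamma2 D w' Z L L') /\
  (forall w, connection_form D w -> cocycle D (gamma1 D w Z)) /\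
  (forall w w', connection_form D w -> connection_form D w' ->
     H2_class D (gamma1 D w Z) = H2_class D (gamma1 D w' Z) /\
     forall L L', lax_algebra D L -> lax_algebra D L' ->
       gamma1 D w Z L L' - gamma1 D w' Z L L' =
       - ((two_pi_i R)^-1 *
          chain_integral Z
            (fun c p => \tr ((w c p - w' c p) *m bracket L L' p)))).
Proof.
split; first exact: gamma2_cocycle.
split; first by move=> w w' _ _ L L' _ _; exact: (gamma2_indep hZ).
split; first exact: gamma1_cocycle.
move=> w w' hw hw'; split; last by move=> L L'; exact: gamma1_change.
by rewrite eqEsubset; split; apply: H2_class_sub; exact: gamma1_change_coboundary.
Qed.
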